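(* $C_4\le 96$, where $C_4:=\sup_{A\in\mathcal{A}_4} C(A\cup B_{2,4},\mathcal{P}_4)$. That is, for every $A\in\mathcal{A}_4$, the set $A\cup B_{2,4}$ can be covered by at most $96$ boxes from $\mathcal{P}_4$.
   Context: $\mathbb{E}^n$ denotes $n$-dimensional Euclidean space, with basic unit vectors $\boldsymbol{e}_1,\dots,\boldsymbol{e}_n$. For a set $A\subset\mathbb{E}^n$ and a family $\mathcal{B}$ of subsets of $\mathbb{E}^n$, $C(A,\mathcal{B})$ is the smallest number of translates of elements of $\mathcal{B}$ required to cover $A$ (different elements of $\mathcal{B}$ may be used). The family $\mathcal{P}_4$ below is invariant under translations. $B_{2,4}$ is the $2$-skeleton of the unit cube $[0,1]^4$, i.e. the union of all $2$-dimensional faces of $[0,1]^4$; equivalently, the set of all points of $[0,1]^4$ having at least two coordinates equal to $0$ or $1$. $\mathcal{A}_4:=\left\{\bigcup_{i=1}^4\{\boldsymbol{x}_i,\boldsymbol{x}_i+\boldsymbol{e}_i\}:\ \boldsymbol{x}_i,\ \boldsymbol{x}_i+\boldsymbol{e}_i\in[0,1]^4 \text{ for } i=1,\dots,4\right\}$; each element of $\mathcal{A}_4$ is a set of at most $8$ points of the boundary of the cube. $\mathcal{P}_4:=\left\{\prod_{i=1}^4[x_i,x_i+\delta_i]:\ x_i\in\mathbb{R},\ \delta_i\ge 0,\ \sum_{i=1}^4\delta_i<1\right\}$, a family of axis-parallel boxes (degenerate sides $\delta_i=0$ are allowed). *)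

(* Defs.v *)
From HB Require Import structures.
From mathcomp Require Import all_boot all_order all_algebra.
From mathcomp Require Import all_classical all_reals all_analysis.

Set Implicit Arguments.
Unset Strict Implicit.
Unset Printing Implicit Defensive.

Import Order.TTheory GRing.Theory Num.Theory.

Local Open Scope classical_set_scope.
Local Open Scope ring_scope.

Definition translate (R : realType) (n : nat) (t : 'rV[R]_n)
    (S : set 'rV[R]_n) : set 'rV[R]_n :=
  [set t + s | s in S].

(* The [m] chosen elements of [F] and translates may repeat, so this says that
   at most [m] distinct translates suffice whenever [F] is nonempty. *)
Definition coverable (R : realType) (n : nat) (A : set 'rV[R]_n)
    (F : set (set 'rV[R]_n)) (m : nat) : Prop :=
  exists (S : 'I_m -> set 'rV[R]_n) (t : 'I_m -> 'rV[R]_n),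
    (forall i, F (S i)) /\ A `<=` \bigcup_i translate (t i) (S i).

(* This is [+oo] when no finite family of translates covers [A]. *)
Definition covering_number (R : realType) (n : nat) (A : set 'rV[R]_n)
    (F : set (set 'rV[R]_n)) : \bar R :=
  ereal_inf [set (m%:R%:E : \bar R) | m in [set m : nat | coverable A F m]].

Definition unit_cube (R : realType) (n : nat) : set 'rV[R]_n :=
  [set x : 'rV[R]_n | forall i, x ord0 i \in `[0, 1]].
Arguments unit_cube R n : clear implicits.

(* The face of dimension [#|J|] whose coordinates in [J] are free, the others
   being fixed to the vertex [v]. *)
Definition cube_face (R : realType) (n : nat) (J : {set 'I_n})
    (v : 'I_n -> bool) : set 'rV[R]_n :=
  [set x | unit_cube R n x /\ forall i, i \notin J -> x ord0 i = (v i)%:R].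

Definition skeleton (R : realType) (k n : nat) : set 'rV[R]_n :=
  [set x | exists (J : {set 'I_n}) (v : 'I_n -> bool),
    #|J| = k /\ cube_face J v x].
Arguments skeleton R k n : clear implicits.

Definition unit_vec (R : realType) (n : nat) (i : 'I_n) : 'rV[R]_n :=
  delta_mx ord0 i.
Arguments unit_vec R {n} i.

Definition familyA (R : realType) (n : nat) : set (set 'rV[R]_n) :=
  [set A | exists x : 'I_n -> 'rV[R]_n,
    (forall i, unit_cube R n (x i) /\ unit_cube R n (x i + unit_vec R i)) /\
    A = \bigcup_i [set x i; x i + unit_vec R i]].
Arguments familyA R n : clear implicits.

Definition familyP (R : realType) (n : nat) : set (set 'rV[R]_n) :=
  [set P | exists x d : 'I_n -> R,
    [/\ forall i, 0 <= d i,
        \sum_i d i < 1 &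
        P = [set y : 'rV[R]_n | forall i, y ord0 i \in `[x i, x i + d i]]]].
Arguments familyP R n : clear implicits.

Definition C4 (R : realType) : \bar R :=
  ereal_sup [set covering_number (A `|` skeleton R 2 4) (familyP R 4)
            | A in familyA R 4].

(* Since the infimum is over naturals it is attained; hence a finite bound on
   the covering number is the existence of a cover by that many boxes. *)
Lemma covering_number_le (R : realType) (n : nat) (A : set 'rV[R]_n)
    (m : nat) :
  (covering_number A (familyP R n) <= m%:R%:E)%E <->
  coverable A (familyP R n) m.
Proof.
split=> [le_m|cov]; last by apply: ereal_inf_lbound; exists m.
have [p covp lepm] : exists2 p, coverable A (familyP R n) p & (p <= m)%N.
  have : (covering_number A (familyP R n) < m.+1%:R%:E)%E.
    by apply: le_lt_trans le_m _; rewrite lte_fin ltr_nat.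
  case/ereal_inf_lt => _ [p covp <-]; rewrite lte_fin ltr_nat ltnS => ?.
  by exists p.
have [P0 FP0] : exists P, familyP R n P.
  exists [set y : 'rV[R]_n | forall i, y ord0 i \in `[0, 0 + 0]].
  by exists (fun=> 0), (fun=> 0); split=> //; rewrite big1.
case: covp => S [t [FS sub]].
exists (fun i => if insub (val i) is Some j then S j else P0).
exists (fun i => if insub (val i) is Some j then t j else 0).
split=> [i|x /sub [j _ xj]]; first by case: insub.
by exists (widen_ord lepm j) => //=; rewrite valK.
Qed.

(* Main.v *)
(* A box with side sum less than [1] meets the 2-skeleton of [[0, 1]^4], whose
   area is [24], in area less than [3/8] if it contains a vertex of the cube and
   less than [1/4] otherwise. Hence 16 vertex boxes and 72 others just fail to
   cover the skeleton, but 88 boxes do cover all of it except a thin slit of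
   length about [1/2] near the centre of one 2-face [F]. The box spent on a
   point [x_i] of [A] can reach the slit as well if, using the symmetries of
   the cube, [F] is taken to be the 2-face nearest to [x_i] and the slit is
   orthogonal to the direction in which [x_i] is farthest from the boundary.
   This only fails when [x_i] is close to the centre of its facet. If all the
   points are that central, the boxes of two points in the two facets meeting
   in [F] cover half of the slit each. The remaining points get one box each,
   so that [88 + 8 = 96] boxes suffice. *)
Require Import Defs.
From Stdlib Require Import NArith Lia.
From mathcomp Require Import all_boot all_order all_fingroup all_algebra.
From mathcomp Require Import all_classical all_reals all_analysis.
From mathcomp Require Import lra.

Set Implicit Arguments.
Unset Strict Implicit.
Unset Printing Implicit Defensive.

Import Order.TTheory GRing.Theory Num.Theory.

(** * The 88 explicit boxes *)

Definition cell := seq (N * N).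

(* Grid coordinates are integers in units of [1 / 10000]. *)
Definition unit_size : N := 10000.

Definition near (b : bool) (w : N) : N * N :=
  if b then ((unit_size - w)%num, unit_size) else (0%num, w).

Definition mid : N * N := (2500%num, 7500%num).

Definition bits : seq bool := [:: false; true].

Definition bits2 : seq (bool * bool) := [seq (a, b) | a <- bits, b <- bits].

(** Next to a side [mid], a full half would bring the side sum to [1]. The unit lost at either end
    is left to the sides of width [1] in [edge_pieces]. *)
Definition halves : seq (N * N) := [:: (1, 5000); (5000, 9999)]%num.

(** The pieces leave only [2497] to [7503] uncovered in the last coordinate; the rounded ends [2450]
    and [7550] give simpler fractions. *)
Definition slit : cell := [:: (0, 0); (0, 0); (4350, 4550); (2450, 7550)]%num.

(** Four sides [2500] would sum to exactly [1], so the last one gives way; this makes the columns of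
    height [5006] instead of [5000]. *)
Definition vertex_pieces : seq cell :=
  [seq [:: near ab.1 2500; near ab.2 2500; near cd.1 2500; near cd.2 2497]
  | ab <- bits2, cd <- bits2].

(** The widths rotate cyclically: a box along direction [i] of the first three is thin in direction
    [i + 1] and wide in [i + 2]. With the vertex boxes this leaves, of a 2-face in directions [i]
    and [i + 1], only [mid] times [[1, 9999]], which two face pieces fill. *)
Definition edge_pieces : seq cell :=
  [seq [:: mid; near a 1; near bc.1 2500; near bc.2 2497]
  | a <- bits, bc <- bits2] ++
  [seq [:: near a 2500; mid; near bc.1 1; near bc.2 2497]
  | a <- bits, bc <- bits2] ++
  [seq [:: near a 1; near bc.1 2500; mid; near bc.2 2497]
  | a <- bits, bc <- bits2].

Definition face_pieces : seq cell :=
  [seq [:: mid; h; near ab.1 0; near ab.2 0]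
  | h <- halves, ab <- bits2] ++
  [seq [:: h; near ab.1 0; mid; near ab.2 0]
  | h <- halves, ab <- bits2] ++
  [seq [:: near ab.1 0; mid; h; near ab.2 0]
  | h <- halves, ab <- bits2].

(* What the other pieces leave over in the middle of the last coordinate is a
   one-dimensional problem: cover the 12 edges of the 3-cube, except the segment
   [4350, 4550] of one of them, with 24 boxes of side sum less than [4994]. *)
Definition column_pieces : seq cell := [seq rcons c (2497, 7503)%num | c <- [::
  [:: (0, 582); (0, 60); (0, 4350)];
  [:: (0, 4526); (0, 7); (9542, 10000)];
  [:: (0, 8); (5051, 10000); (0, 35)];
  [:: (0, 8); (9990, 10000); (5026, 10000)];
  [:: (5574, 10000); (0, 60); (0, 506)];
  [:: (9518, 10000); (0, 7); (5498, 10000)];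
  [:: (9992, 10000); (5051, 10000); (0, 35)];
  [:: (9992, 10000); (9990, 10000); (5026, 10000)];
  [:: (582, 5574); (0, 0); (0, 0)];
  [:: (4526, 9518); (0, 0); (10000, 10000)];
  [:: (8, 5000); (10000, 10000); (0, 0)];
  [:: (5000, 9992); (10000, 10000); (0, 0)];
  [:: (8, 5000); (10000, 10000); (10000, 10000)];
  [:: (5000, 9992); (10000, 10000); (10000, 10000)];
  [:: (0, 0); (60, 5051); (0, 0)];
  [:: (0, 0); (7, 4999); (10000, 10000)];
  [:: (0, 0); (4999, 9990); (10000, 10000)];
  [:: (10000, 10000); (60, 5051); (0, 0)];
  [:: (10000, 10000); (7, 4999); (10000, 10000)];
  [:: (10000, 10000); (4999, 9990); (10000, 10000)];
  [:: (0, 0); (0, 0); (4550, 9542)];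
  [:: (0, 0); (10000, 10000); (35, 5026)];
  [:: (10000, 10000); (0, 0); (506, 5498)];
  [:: (10000, 10000); (10000, 10000); (35, 5026)]]%num].

Definition pieces : seq cell :=
  vertex_pieces ++ edge_pieces ++ face_pieces ++ column_pieces.

Lemma size_pieces : size pieces = 88%N.
Proof. by []. Qed.

(** The upper ends are compared with the lower ends plus [1] because subtraction in [N]
    truncates. *)
Definition small_cell (c : cell) : bool :=
  [&& size c == 4%N, all (fun p => (p.1 <=? p.2)%num) c &
      (foldr N.add 0 (unzip2 c) <? foldr N.add 0 (unzip1 c) + unit_size)%num].

Lemma all_small_pieces : all small_cell pieces.
Proof. by vm_compute. Qed.

(** * A decision procedure for covers of the 2-skeleton *)

Definition subcell (c b : cell) : bool :=
  all2 (fun p q => (q.1 <=? p.1)%num && (p.2 <=? q.2)%num) c b.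

Fixpoint subdivide (P : N -> N -> bool) (lo : N) (cuts : seq N) (hi : N) :
    bool :=
  if cuts is c :: cuts' then P lo c && subdivide P c cuts' hi else P lo hi.

Fixpoint all_cells (Q : cell -> bool) (ds : seq (N * N * seq N)) : bool :=
  if ds is (lh, cuts) :: ds' then
    subdivide (fun a b => all_cells (fun c => Q ((a, b) :: c)) ds')
      lh.1 cuts lh.2
  else Q [::].

(* A face of the cube is encoded by the fixed value, if any, of each
   coordinate. *)
Definition side (o : option bool) : N * N :=
  if o is Some b then near b 0 else (0%num, unit_size).

Definition meets (f : seq (option bool)) (b : cell) : bool :=
  all2 (fun o p => if o is None then true else
    (p.1 <=? (side o).1)%num && ((side o).2 <=? p.2)%num) f b.

Definition cuts (bs : seq cell) (k : nat) : seq N :=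
  sort N.leb (undup (flatten
    [seq let p := nth (0%num, 0%num) b k in [:: p.1; p.2] | b <- bs])).

(** Boxes missing the face are dropped. The ends of the others cut it into a grid whose cells no box
    splits, so a cover must contain each cell in a single box. *)
Definition check_face (bs : seq cell) (f : seq (option bool)) : bool :=
  let bs' := seq.filter (meets f) bs in
  all_cells (fun c => has (subcell c) bs')
    (mkseq (fun k => let o := nth None f k in
              (side o, if o is None then cuts bs' k else [::])) 4).

Definition two_fixed (i j : nat) (b c : bool) : seq (option bool) :=
  mkseq (fun k => if k == i then Some b else if k == j then Some c else None) 4.

Definition check_cover (bs : seq cell) : bool :=
  all (fun i => all (fun j => (i == j) ||
    all (fun b => all (fun c => check_face bs (two_fixed i j b c)) bits) bits)
    (iota 0 4)) (iota 0 4).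

Lemma pieces_cover : check_cover (slit :: pieces).
Proof. by vm_compute. Qed.

(** * Soundness of the check over the reals *)

Section Embedding.
Variable R : realType.
Local Open Scope ring_scope.

Definition grid_pt (n : N) : R := (N.to_nat n)%:R / (N.to_nat unit_size)%:R.

Let unit_gt0 : 0 < (N.to_nat unit_size)%:R :> R.
Proof. by rewrite ltr0n; apply/ssrnat.ltP; rewrite /unit_size; lia. Qed.

Lemma grid_pt_le (m n : N) : (m <=? n)%num -> grid_pt m <= grid_pt n.
Proof.
move/N.leb_le => le_mn; rewrite ler_pM2r ?invr_gt0// ler_nat.
by apply/ssrnat.leP; lia.
Qed.

Lemma grid_pt_lt (m n : N) : (m <? n)%num -> grid_pt m < grid_pt n.
Proof.
move/N.ltb_lt => lt_mn; rewrite ltr_pM2r ?invr_gt0// ltr_nat.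
by apply/ssrnat.ltP; lia.
Qed.

Lemma grid_ptD (m n : N) : grid_pt (m + n)%num = grid_pt m + grid_pt n.
Proof. by rewrite /grid_pt Nnat.N2Nat.inj_add natrD mulrDl. Qed.

(** Cross-multiplication takes place in binary [N], so no unary numeral of size [10000] is ever
    computed. *)
Lemma grid_ptE (n : N) (a b : nat) : (0 < b)%N ->
  (n * N.of_nat b =? N.of_nat a * unit_size)%num -> grid_pt n = a%:R / b%:R.
Proof.
move=> b_gt0 /N.eqb_eq /(congr1 N.to_nat).
rewrite !Nnat.N2Nat.inj_mul !Nnat.Nat2N.id !multE => eq_nb.
have nz_b : b%:R != 0 :> R by rewrite pnatr_eq0 -lt0n.
apply/eqP; rewrite eqr_div ?(gt_eqF unit_gt0)//.
by rewrite -!natrM eq_nb.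
Qed.

Lemma grid_pt0 : grid_pt 0 = 0.
Proof. by rewrite /grid_pt mul0r. Qed.

Lemma grid_pt1 : grid_pt unit_size = 1.
Proof. by rewrite /grid_pt divff ?gt_eqF. Qed.

Definition fits (c : cell) (xs : seq R) : bool :=
  all2 (fun p x => grid_pt p.1 <= x <= grid_pt p.2) c xs.

(** Comparing [t] with the next cut either finds its interval or makes that cut the new lower end;
    soundness thus never refers to the order of the cuts. *)
Lemma subdivideP (P : N -> N -> bool) (lo hi : N) (cs : seq N) (t : R) :
    subdivide P lo cs hi -> grid_pt lo <= t <= grid_pt hi ->
  exists a b, P a b /\ grid_pt a <= t <= grid_pt b.
Proof.
elim: cs lo => [|c cs IHcs] lo /=; first by exists lo, hi.
case/andP=> Pc Pcs /andP[lot thi]; have [tc|/ltW ct] := leP t (grid_pt c).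
  by exists lo, c; rewrite lot tc.
by apply: IHcs Pcs _; rewrite ct thi.
Qed.

Lemma all_cellsP (Q : cell -> bool) (ds : seq (N * N * seq N)) (xs : seq R) :
  all_cells Q ds -> fits (unzip1 ds) xs -> exists2 c, Q c & fits c xs.
Proof.
elim: ds Q xs => [|[[lo hi] cs] ds IHds] Q [|x xs]//=; first by exists [::].
move=> Qds /andP[xin fxs].
have [a [b [Qab xab]]] := subdivideP Qds xin.
have [c Qc cxs] := IHds _ _ Qab fxs.
by exists ((a, b) :: c) => //=; rewrite xab.
Qed.

Lemma fits_subcell (c b : cell) (xs : seq R) :
  subcell c b -> fits c xs -> fits b xs.
Proof.
elim: c b xs => [|p c IHc] [|q b] [|x xs]//= /andP[/andP[qp1 pq2] sub_cb].
case/andP=> /andP[px xp] fc; rewrite (IHc b)// andbT.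
by rewrite (le_trans (grid_pt_le qp1) px) (le_trans xp (grid_pt_le pq2)).
Qed.

Lemma check_faceP (bs : seq cell) (f : seq (option bool)) (xs : seq R) :
    size f = 4%N -> check_face bs f -> fits [seq side o | o <- f] xs ->
  exists2 b, b \in bs & fits b xs.
Proof.
move=> sz_f chk fxs; have [|c] := all_cellsP chk (xs := xs).
  by case: f sz_f {chk} fxs => [|? [|? [|? [|? []]]]].
case/hasP=> b; rewrite mem_filter => /andP[_ b_bs] sub_cb cxs.
by exists b => //; apply: fits_subcell cxs.
Qed.

Definition coords (x : 'rV[R]_4) : seq R := mkseq (fun k => x ord0 (inord k)) 4.

Definition skel_pt (x : 'rV[R]_4) : Prop :=
  (forall i, 0 <= x ord0 i <= 1) /\
  exists i j (b c : bool), [/\ i != j, x ord0 i = b%:R & x ord0 j = c%:R].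

Lemma check_coverP (bs : seq cell) (x : 'rV[R]_4) :
  check_cover bs -> skel_pt x -> exists2 b, b \in bs & fits b (coords x).
Proof.
move=> chk [x01 [i [j [b [c [ne_ij xi xj]]]]]].
have in_bits d : d \in bits by case: d.
have chk_f : check_face bs (two_fixed i j b c).
  have in_iota (l : 'I_4) : val l \in iota 0 4 by rewrite mem_iota ltn_ord.
  move: chk; rewrite /check_cover => /seq.allP/(_ _ (in_iota i)).
  move/seq.allP/(_ _ (in_iota j)).
  rewrite val_eqE (negPf ne_ij) orFb => chk.
  by move: chk => /seq.allP/(_ b (in_bits b))/seq.allP/(_ c (in_bits c)).
apply: check_faceP chk_f _; first by rewrite size_mkseq.
pose o (k : nat) := if k == i then Some b else if k == j then Some c else None.
have xo (k : nat) : (k < 4)%N ->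
    grid_pt (side (o k)).1 <= x ord0 (inord k) <= grid_pt (side (o k)).2.
  move=> k4; have eq_k (l : 'I_4) : (k == l) = (inord k == l).
    by rewrite -val_eqE /= inordK.
  rewrite /o !eq_k.
  case: eqP => [->|_]; last case: eqP => [->|_].
  - by rewrite xi; case: (b); rewrite /= ?grid_pt0 ?grid_pt1 lexx.
  - by rewrite xj; case: (c); rewrite /= ?grid_pt0 ?grid_pt1 lexx.
  - by rewrite /= grid_pt0 grid_pt1.
by rewrite /fits /= -!/(o _) !xo.
Qed.
End Embedding.

(** * Covers by boxes and the symmetries of the cube *)

Section Boxes.
Variables (R : realType) (n : nat).
Local Open Scope ring_scope.

Definition box : Type := ('rV[R]_n * 'rV[R]_n)%type.

Definition in_box (B : box) (x : 'rV[R]_n) : Prop :=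
  forall i, B.1 ord0 i <= x ord0 i <= B.2 ord0 i.

Definition small_box (B : box) : Prop :=
  (forall i, B.1 ord0 i <= B.2 ord0 i) /\
  \sum_i (B.2 ord0 i - B.1 ord0 i) < 1.

Definition point_box (x : 'rV[R]_n) : box := (x, x).

Lemma small_point_box (x : 'rV[R]_n) : small_box (point_box x).
Proof.
by split=> [i|]; rewrite //= big1 ?ltr01// => i _; rewrite subrr.
Qed.

Lemma in_point_box (x : 'rV[R]_n) : in_box (point_box x) x.
Proof. by move=> i; rewrite lexx. Qed.

Lemma coverable_boxes (A : set 'rV[R]_n) (L : seq box) (m : nat) :
    (size L <= m)%N -> {in L, forall B, small_box B} ->
    (forall x, A x -> exists2 B, B \in L & in_box B x) ->
  coverable A (Defs.familyP R n) m.
Proof.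
(* A list shorter than [m] is padded with the one-point box at the origin; the boxes are already in
   place, so all translations are by [0]. *)
move=> sz_L smallL coverA; pose B (i : 'I_m) := nth (point_box 0) L i.
have smallB i : small_box (B i).
  rewrite /B; have [lt_i|ge_i] := ltnP i (size L).
    by apply: smallL; rewrite mem_nth.
  by rewrite nth_default//; apply: small_point_box.
exists (fun i => [set y | forall k, y ord0 k \in
  `[(B i).1 ord0 k,
    (B i).1 ord0 k + ((B i).2 ord0 k - (B i).1 ord0 k)]%R]%classic).
exists (fun=> 0); split=> [i|x /coverA [C CL Cx]].
  have [le_B sum_B] := smallB i.
  exists (fun k => (B i).1 ord0 k), (fun k => (B i).2 ord0 k - (B i).1 ord0 k).
  by split=> // k; rewrite subr_ge0.
have lt_C : (index C L < m)%N by apply: leq_trans sz_L; rewrite index_mem.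
exists (Ordinal lt_C) => //=; exists x; last by rewrite add0r.
by move=> k; rewrite /B /= nth_index// addrC subrK in_itv /=; apply: Cx.
Qed.

Definition flip (b : bool) (t : R) : R := if b then 1 - t else t.

(** The symmetries of the unit cube: permutations of the coordinates combined with reflections. *)
Definition act (s : 'S_n) (e : 'I_n -> bool) (x : 'rV[R]_n) : 'rV[R]_n :=
  \row_k flip (e k) (x ord0 (s k)).

(** The preimage of a box under [act s e]; a reflection exchanges the two ends of a side. *)
Definition pull (s : 'S_n) (e : 'I_n -> bool) (B : box) : box :=
  let k i := (s^-1)%g i in
  (\row_i (if e (k i) then 1 - B.2 ord0 (k i) else B.1 ord0 (k i)),
   \row_i (if e (k i) then 1 - B.1 ord0 (k i) else B.2 ord0 (k i))).

Lemma in_box_pull (s : 'S_n) (e : 'I_n -> bool) (B : box) (x : 'rV[R]_n) :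
  in_box B (act s e x) -> in_box (pull s e B) x.
Proof.
move=> Bx i; rewrite !mxE; have := Bx ((s^-1)%g i).
rewrite mxE permKV /flip; case: (e _) => // /andP[? ?].
by apply/andP; split; lra.
Qed.

Lemma small_pull (s : 'S_n) (e : 'I_n -> bool) (B : box) :
  small_box B -> small_box (pull s e B).
Proof.
case=> le_B sum_B; split=> [i|].
  by rewrite !mxE; have := le_B ((s^-1)%g i); case: (e _) => // ?; lra.
rewrite (reindex_inj (@perm_inj _ s)) /=; apply: le_lt_trans sum_B.
apply: ler_sum => i _; rewrite !mxE permK; case: (e i) => //.
by lra.
Qed.

End Boxes.

(** * The cover of the 2-skeleton, up to symmetry *)

Section FourCube.
Variable R : realType.
Local Open Scope ring_scope.

Local Notation o0 := (@Ordinal 4 0 isT).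
Local Notation o1 := (@Ordinal 4 1 isT).
Local Notation o2 := (@Ordinal 4 2 isT).
Local Notation o3 := (@Ordinal 4 3 isT).

Lemma forall_I4 (P : 'I_4 -> Prop) :
  P o0 -> P o1 -> P o2 -> P o3 -> forall i, P i.
Proof.
move=> P0 P1 P2 P3 [[|[|[|[|//]]]] lt_i].
- by rewrite (_ : Ordinal _ = o0)//; apply: val_inj.
- by rewrite (_ : Ordinal _ = o1)//; apply: val_inj.
- by rewrite (_ : Ordinal _ = o2)//; apply: val_inj.
- by rewrite (_ : Ordinal _ = o3)//; apply: val_inj.
Qed.

Lemma sum_I4 (f : 'I_4 -> R) : \sum_i f i = f o0 + f o1 + f o2 + f o3.
Proof.
rewrite !big_ord_recl big_ord0 addr0 !addrA.
by congr (f _ + f _ + f _ + f _); apply: val_inj.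
Qed.

Definition vec4 (a b c d : R) : 'rV[R]_4 :=
  \row_i nth 0 [:: a; b; c; d] i.

Definition cell_box (c : cell) : box R 4 :=
  (\row_i grid_pt R (nth (0%num, 0%num) c i).1,
   \row_i grid_pt R (nth (0%num, 0%num) c i).2).

Lemma fits_in_box (c : cell) (x : 'rV[R]_4) :
  size c = 4%N -> fits c (coords x) -> in_box (cell_box c) x.
Proof.
case: c => [|p0 [|p1 [|p2 [|p3 []]]]]//= _ /and5P[x0 x1 x2 x3 _] i.
rewrite !mxE; move: i; apply: forall_I4 => /=.
- by rewrite (_ : o0 = inord 0)//; apply: val_inj; rewrite /= inordK.
- by rewrite (_ : o1 = inord 1)//; apply: val_inj; rewrite /= inordK.
- by rewrite (_ : o2 = inord 2)//; apply: val_inj; rewrite /= inordK.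
- by rewrite (_ : o3 = inord 3)//; apply: val_inj; rewrite /= inordK.
Qed.

Lemma small_cell_box (c : cell) : small_cell c -> small_box (cell_box c).
Proof.
case: c => [|p0 [|p1 [|p2 [|p3 []]]]]//= /and3P[_ /and5P[le0 le1 le2 le3 _]].
move=> /(grid_pt_lt R); rewrite /= !grid_ptD grid_pt0 grid_pt1 => lt_sum.
split=> [i|]; last by rewrite sum_I4 !mxE /=; lra.
by rewrite !mxE; move: i; apply: forall_I4; apply: grid_pt_le.
Qed.

Lemma skeleton_skel_pt (x : 'rV[R]_4) : skeleton R 2 4 x -> skel_pt x.
Proof.
case=> J [v [card_J [x01 xv]]]; split=> [i|].
  by have := x01 i; rewrite in_itv.
have /cards2P[i [j [ne_ij defJ]]] : #|~: J| == 2%N.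
  by rewrite -(eqn_add2l #|J|) cardsC card_J card_ord.
exists i, j, (v i), (v j); split=> //; apply: xv.
  by rewrite -finset.in_setC defJ finset.set21.
by rewrite -finset.in_setC defJ finset.set22.
Qed.

Lemma skel_pt_act (s : 'S_4) (e : 'I_4 -> bool) (x : 'rV[R]_4) :
  skel_pt x -> skel_pt (act s e x).
Proof.
case=> x01 [i [j [b [c [ne_ij xi xj]]]]]; split=> [k|].
  rewrite mxE /flip; have := x01 (s k); case: (e k) => // /andP[? ?].
  by apply/andP; split; lra.
exists (s^-1 i)%g, (s^-1 j)%g, (b (+) e (s^-1 i)%g), (c (+) e (s^-1 j)%g).
rewrite !mxE !permKV xi xj (inj_eq perm_inj); split=> //; rewrite /flip.
  by case: b {xi} => /=; case: (e _) => /=; lra.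
by case: c {xj} => /=; case: (e _) => /=; lra.
Qed.

Definition base : seq (box R 4) := [seq cell_box c | c <- pieces].

Lemma size_piece (c : cell) : c \in slit :: pieces -> size c = 4%N.
Proof.
have /seq.allP size4 : all (fun c => size c == 4%N) (slit :: pieces) by [].
by move=> /size4 /eqP.
Qed.

Lemma skel_pt_cover (x : 'rV[R]_4) : skel_pt x ->
  in_box (cell_box slit) x \/ exists2 B, B \in base & in_box B x.
Proof.
move=> /(check_coverP pieces_cover)[c c_in cx].
have cBx := fits_in_box (size_piece c_in) cx.
move: c_in; rewrite inE => /predU1P[<-|c_p]; first by left.
by right; exists (cell_box c) => //; apply: map_f.
Qed.

(** Symmetries preserve the skeleton, so a cover found in normal position can be pulled back. Beyond
    the 88 base boxes, the 8 available ones are shared between the slit ([Ps]) and the points that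
    get a box of their own ([pts]). *)
Lemma coverable_act (s : 'S_4) (e : 'I_4 -> bool) (Ps : seq (box R 4))
    (pts : seq 'rV[R]_4) (A : set 'rV[R]_4) :
    {in Ps, forall B, small_box B} -> (size Ps + size pts <= 8)%N ->
    (forall x, in_box (cell_box slit) x -> exists2 B, B \in Ps & in_box B x) ->
    (forall a, A a -> a \in pts \/
       exists2 B, B \in Ps ++ base & in_box B (act s e a)) ->
  coverable (A `|` skeleton R 2 4)%classic (Defs.familyP R 4) 96.
Proof.
move=> smallPs sz slitPs coverA.
pose L := [seq pull s e B | B <- Ps ++ base] ++ [seq point_box a | a <- pts].
have inL B x : B \in Ps ++ base -> in_box B (act s e x) ->
    exists2 C, C \in L & in_box C x.
  move=> B_in Bx; exists (pull s e B); last exact: in_box_pull.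
  by rewrite mem_cat map_f.
apply: (@coverable_boxes _ _ _ L) => [|B|x [/coverA[x_pts|[B B_in Bx]]|]].
- rewrite size_cat !size_map size_cat size_map size_pieces.
  by rewrite addnAC addnC (leq_add2l 88 _ 8).
- rewrite mem_cat => /orP[/mapP[C C_in ->]|/mapP[a _ ->]]; last first.
    exact: small_point_box.
  apply: small_pull; move: C_in; rewrite mem_cat.
  case/orP=> [/smallPs//|/mapP[c c_in ->]].
  by apply: small_cell_box; apply: (seq.allP all_small_pieces).
- exists (point_box x); last exact: in_point_box.
  by rewrite mem_cat map_f ?orbT.
- exact: inL Bx.
move=> /skeleton_skel_pt/(skel_pt_act s e)/skel_pt_cover[/slitPs|] [B B_in].
  by apply: inL; rewrite mem_cat B_in.
by apply: inL; rewrite mem_cat B_in orbT.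
Qed.

(** * Boxes joining the slit to a point *)

Lemma in_vec4_box (a b c d a' b' c' d' : R) (x : 'rV[R]_4) :
    a <= x ord0 o0 <= a' -> b <= x ord0 o1 <= b' ->
    c <= x ord0 o2 <= c' -> d <= x ord0 o3 <= d' ->
  in_box (vec4 a b c d, vec4 a' b' c' d') x.
Proof. by move=> xa xb xc xd i; rewrite !mxE; move: i; apply: forall_I4. Qed.

Lemma small_vec4_box (a b c d a' b' c' d' : R) :
    a <= a' -> b <= b' -> c <= c' -> d <= d' ->
    (a' - a) + (b' - b) + (c' - c) + (d' - d) < 1 ->
  small_box (vec4 a b c d, vec4 a' b' c' d').
Proof.
move=> la lb lc ld lt_sum; split; last by rewrite sum_I4 !mxE.
by move=> i; rewrite !mxE; move: i; apply: forall_I4.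
Qed.

Lemma in_slit (x : 'rV[R]_4) : in_box (cell_box slit) x ->
  [/\ x ord0 o0 = 0, x ord0 o1 = 0, 87 / 200 <= x ord0 o2 <= 91 / 200
    & 49 / 200 <= x ord0 o3 <= 151 / 200].
Proof.
move=> x_in; have := (x_in o0, x_in o1, x_in o2, x_in o3).
rewrite !mxE /= grid_pt0.
rewrite (@grid_ptE _ 4350 87 200)// (@grid_ptE _ 4550 91 200)//.
rewrite (@grid_ptE _ 2450 49 200)// (@grid_ptE _ 7550 151 200)//.
by case=> [[[x0 x1] x2] x3]; split=> //; apply/eqP; rewrite eq_le andbC.
Qed.

Lemma corner_cover (x : 'rV[R]_4) : (forall i, 0 <= x ord0 i <= 6 / 25) ->
  exists2 B, B \in base & in_box B x.
Proof.
move=> x_small.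
exists (cell_box [:: (0, 2500); (0, 2500); (0, 2500); (0, 2497)]%num).
  by apply: map_f; vm_compute.
(* In grid units [6 / 25] is [2400], below both side lengths of the vertex piece at the origin. *)
have le2500 : 6 / 25 <= grid_pt R 2500 by rewrite (@grid_ptE _ 2500 1 4)//; lra.
have le2497 : 6 / 25 <= grid_pt R 2497.
  rewrite (le_trans _ (@grid_pt_le R 2400 2497 isT))//.
  by rewrite (@grid_ptE _ 2400 6 25).
move=> i; rewrite !mxE; have /andP[x_ge x_le] := x_small i.
move: i x_ge x_le; apply: forall_I4 => /= x_ge x_le; rewrite grid_pt0 x_ge /=.
all: exact: le_trans x_le _.
Qed.

(** [P] is the smallest box around the slit and [y]. Its side in direction 1 is [y_1]; a large [y_2]
    keeps the third side short, and [y_1 <= y_3] pays for any extension of the fourth. *)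
Lemma reach_slit (y : 'rV[R]_4) :
    y ord0 o0 = 0 -> 0 <= y ord0 o1 -> y ord0 o1 <= y ord0 o3 ->
    y ord0 o3 <= y ord0 o2 -> y ord0 o2 <= 1 / 2 ->
    y ord0 o1 + y ord0 o2 < 37 / 40 ->
  exists P, [/\ small_box P, forall x, in_box (cell_box slit) x -> in_box P x &
    in_box P y \/ exists2 B, B \in base & in_box B y].
Proof.
move=> y0 y1 y13 y32 y2 y12.
(* The threshold is [91 / 200 - 49 / 200]. Below it all coordinates of [y] are small, so the vertex
   piece contains [y] and [P] may be the slit itself. *)
have [y2_small|y2_big] := leP (y ord0 o2) (21 / 100).
  exists (vec4 0 0 (87 / 200) (49 / 200),
          vec4 0 0 (91 / 200) (151 / 200)); split.
  - by apply: small_vec4_box; lra.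
  - move=> x /in_slit[x0 x1 x2 x3].
    by apply: in_vec4_box => //; rewrite ?x0 ?x1 lexx.
  - by right; apply: corner_cover; apply: forall_I4; lra.
(* The last two bounds make [P] small for [d = 49 / 200] and for [d = y_3] respectively. If [y_2]
   exceeds [91 / 200], the first is the hypothesis with [37 / 40 = 49 / 100 + 87 / 200]. *)
have [c [c' [ccy [ccs small_c]]]] : exists c c',
    [/\ c <= y ord0 o2 <= c' , c <= 87 / 200 /\ 91 / 200 <= c',
      y ord0 o1 + (c' - c) < 49 / 100 & c' - c < 49 / 200].
  have [le_s|gt_s] := leP (y ord0 o2) (87 / 200).
    by exists (y ord0 o2), (91 / 200); split; [apply/andP; split|split| |]; lra.
  have [le_t|gt_t] := leP (y ord0 o2) (91 / 200).
    by exists (87 / 200), (91 / 200); split; [apply/andP; split|split| |]; lra.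
  by exists (87 / 200), (y ord0 o2); split; [apply/andP; split|split| |]; lra.
have [d [ddy [dds small_d]]] : exists d,
    [/\ d <= y ord0 o3, d <= 49 / 200 & d = 49 / 200 \/ d = y ord0 o3].
  have [le_s|/ltW gt_s] := leP (y ord0 o3) (49 / 200).
    by exists (y ord0 o3); split=> //; right.
  by exists (49 / 200); split=> //; left.
exists (vec4 0 0 c d, vec4 0 (y ord0 o1) c' (151 / 200)).
split.
- apply: small_vec4_box; lra.
- move=> x /in_slit[x0 x1 /andP[x2 x2'] /andP[x3 x3']].
  by apply: in_vec4_box; apply/andP; split; lra.
- by left; apply: in_vec4_box; apply/andP; split; lra.
Qed.

(** * Normal position of a point and the final case distinction *)

Lemma sort3 (d : 'I_4 -> R) :
  exists2 u : 'S_4, u o0 = o0 & d (u o1) <= d (u o3) <= d (u o2).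
Proof.
have tryu (u : 'S_4) : u o0 = o0 -> d (u o1) <= d (u o3) <= d (u o2) ->
  exists2 u : 'S_4, u o0 = o0 & d (u o1) <= d (u o3) <= d (u o2) by exists u.
have [d12|/ltW d12] := leP (d o1) (d o2);
  have [d13|/ltW d13] := leP (d o1) (d o3);
  have [d23|/ltW d23] := leP (d o2) (d o3).
- by apply: (tryu (tperm o2 o3)); rewrite !permE /= ?d12.
- by apply: (tryu 1%g); rewrite !permE /= ?d13.
(* The three comparisons form a cycle, so all values agree; the same happens in the other case
   settled by [lra]. *)
- by apply: (tryu 1%g); rewrite !permE //=; lra.
- by apply: (tryu (tperm o1 o3)); rewrite !permE /= ?d13.
- by apply: (tryu (tperm o1 o2 * tperm o1 o3)%g);
    rewrite !permE /= ?permE /= ?d12.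
- by apply: (tryu 1%g); rewrite !permE //=; lra.
- by apply: (tryu (tperm o1 o2)); rewrite !permE /= ?d23.
- by apply: (tryu (tperm o1 o3 * tperm o1 o2)%g);
    rewrite !permE /= ?permE /= ?d23.
Qed.

(** Reflections replace each coordinate by its distance [d] to the boundary, and a permutation sorts
    them with [i] first. The last clause turns a large [y_1] into centrality of [a] in its facet. *)
Lemma normalize (a : 'rV[R]_4) (i : 'I_4) :
    (forall k, 0 <= a ord0 k <= 1) -> a ord0 i = 0 ->
  exists s e, let y := act s e a in
    [/\ y ord0 o0 = 0, 0 <= y ord0 o1 <= y ord0 o3,
        y ord0 o3 <= y ord0 o2 <= 1 / 2 &
        forall j, j != i -> y ord0 o1 <= a ord0 j <= 1 - y ord0 o1].
Proof.
move=> a01 ai; pose d k := Num.min (a ord0 k) (1 - a ord0 k).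
have d_bounds k :
    [/\ 0 <= d k, d k <= 1 / 2, d k <= a ord0 k & d k <= 1 - a ord0 k].
  by have /andP[? ?] := a01 k; rewrite /d;
    case: (leP (a ord0 k) (1 - a ord0 k)) => ?; split; lra.
have [u u0 /andP[d13 d32]] := sort3 (fun k => d (tperm o0 i k)).
pose s := (u * tperm o0 i)%g.
exists s, (fun k => 1 / 2 < a ord0 (s k)) => y.
have yE k : y ord0 k = d (s k).
  by rewrite mxE /flip /d; case: (leP (a ord0 (s k)) (1 - a ord0 (s k))) => ?;
    case: (ltP (1 / 2)) => ?; lra.
have sE k : s k = tperm o0 i (u k) by rewrite permM.
have s0 : s o0 = i by rewrite sE u0 tpermL.
have min1 k : k != o0 -> d (s o1) <= d (s k).
  rewrite !sE; move: k; apply: forall_I4 => // _.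
  exact: le_trans d13 d32.
rewrite !yE s0 !sE; split.
- by rewrite /d ai subr0 min_l.
- by rewrite d13 andbT; have [] := d_bounds (tperm o0 i (u o1)).
- by rewrite d32; have [] := d_bounds (tperm o0 i (u o2)).
move=> j; rewrite -(permKV s j) -{1}s0 (inj_eq perm_inj) -sE => /min1 le_d.
have [_ _ le_a le_1a] := d_bounds (s (s^-1 j)%g).
by apply/andP; split; lra.
Qed.

Lemma coverable_familyA (x : 'I_4 -> 'rV[R]_4) :
    (forall i, unit_cube R 4 (x i) /\ unit_cube R 4 (x i + unit_vec R i)) ->
  coverable
    ((\bigcup_i [set x i; x i + unit_vec R i]) `|` skeleton R 2 4)%classic
    (Defs.familyP R 4) 96.
Proof.
move=> x_cube.
have x01 i k : 0 <= x i ord0 k <= 1.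
  by have [/(_ k)] := x_cube i; rewrite in_itv.
have xD i k : (x i + unit_vec R i) ord0 k = x i ord0 k + (k == i)%:R.
  by rewrite !mxE eqxx.
have xi0 i : x i ord0 i = 0.
  have [_ /(_ i)] := x_cube i; rewrite in_itv /= xD eqxx mulr1n => /andP[_ ?].
  by have /andP[? _] := x01 i i; lra.
have [[i far_i]|all_near] := pselect (exists i,
    ~ forall j, j != i -> 17 / 40 <= x i ord0 j <= 23 / 40).
  have [s [e]] := normalize (x01 i) (xi0 i).
  set y := act s e (x i) => -[y0 /andP[y1 y13] /andP[y32 y2] y1x].
  (* Otherwise [y_2 <= 1 / 2] forces [y_1 >= 17 / 40], and the point would be central. *)
  have y12 : y ord0 o1 + y ord0 o2 < 37 / 40.
    rewrite ltNge; apply/negP => y_near; apply: far_i => j /y1x /andP[? ?].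
    by apply/andP; split; lra.
  have [P [smallP slitP Py]] := reach_slit y0 y1 y13 y32 y2 y12.
  (* One box serves the slit and, unless a base box does, [x i]; the other seven points get their
     own. *)
  pose pts := [seq x k | k in predC1 i] ++
    [seq x k + unit_vec R k | k <- enum 'I_4].
  apply: (@coverable_act s e [:: P] pts).
  - by move=> B; rewrite inE => /eqP ->.
  - by rewrite size_cat size_image size_map cardC1 size_enum_ord card_ord.
  - by move=> z /slitP; exists P; rewrite ?inE.
  move=> a [k _ [->|->]].
    have [->|ne_ki] := eqVneq k i; last first.
      by left; rewrite mem_cat; apply/orP; left; apply: fintype.image_f.
    right; case: Py => [|[B B_in]] By; first by exists P; rewrite ?inE ?eqxx.
    by exists B; rewrite // inE B_in orbT.
  by left; rewrite mem_cat; apply/orP; right; apply: map_f; rewrite mem_enum.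
have near i j : j != i -> 17 / 40 <= x i ord0 j <= 23 / 40.
  move: j; have [//|far_i] := pselect (forall j, j != i ->
    17 / 40 <= x i ord0 j <= 23 / 40).
  by case: all_near; exists i.
(* Each of the first two coordinates is reflected according to the other pair's point, which brings
   it to at most [1 / 2]. The points [v o0 e0] and [v o1 e1] then land in the facets where
   coordinate 0, respectively 1, vanishes. *)
pose e0 := 1 / 2 < x o1 ord0 o0; pose e1 := 1 / 2 < x o0 ord0 o1.
pose e (k : 'I_4) := nth false [:: e0; e1] k.
(* Each box contains one of these points and the part of the slit on one side of [1 / 2] in the last
   coordinate; both side sums are [49 / 50]. Six points remain. *)
pose P0 : box R 4 := (vec4 0 0 (17 / 40) (49 / 200),
                      vec4 0 (1 / 2) (23 / 40) (23 / 40)).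
pose P1 : box R 4 := (vec4 0 0 (17 / 40) (17 / 40),
                      vec4 (1 / 2) 0 (23 / 40) (151 / 200)).
pose v i b : 'rV[R]_4 := if b then x i + unit_vec R i else x i.
have vE i b k : v i b ord0 k = x i ord0 k + (b && (k == i))%:R.
  by rewrite /v; case: b; rewrite ?xD// addr0.
have act_v i b k : act 1%g e (v i b) ord0 k = flip (e k) (v i b ord0 k).
  by rewrite mxE perm1.
apply: (@coverable_act 1%g e [:: P0; P1]
  [:: v o0 (~~ e0); v o1 (~~ e1);
      v o2 false; v o2 true; v o3 false; v o3 true]).
- by move=> B; rewrite !inE => /orP[] /eqP ->; apply: small_vec4_box; lra.
- by [].
- move=> z /in_slit[z0 z1 /andP[z2 z2'] /andP[z3 z3']].
  have [le_z|/ltW ge_z] := leP (z ord0 o3) (1 / 2).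
    exists P0; rewrite ?inE ?eqxx//.
    by apply: in_vec4_box; apply/andP; split; lra.
  exists P1; rewrite ?inE ?eqxx ?orbT//.
  by apply: in_vec4_box; apply/andP; split; lra.
move=> a [k _ av]; have {av} [b ->] : exists b, a = v k b.
  by case: av => ->; [exists false|exists true].
have in_P0 : in_box P0 (act 1%g e (v o0 e0)).
  apply: in_vec4_box; rewrite act_v vE /e /= ?andbF ?andbT ?addr0 /flip.
  - by rewrite xi0 add0r; case: (e0); rewrite /= ?mulr1n ?subrr lexx.
  - have /andP[? ?] := x01 o0 o1; rewrite /e1.
    by case: ltP => ?; apply/andP; split; lra.
  - by have /andP[? ?] := near o0 o2 isT; apply/andP; split; lra.
  - by have /andP[? ?] := near o0 o3 isT; apply/andP; split; lra.
have in_P1 : in_box P1 (act 1%g e (v o1 e1)).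
  apply: in_vec4_box; rewrite act_v vE /e /= ?andbF ?andbT ?addr0 /flip.
  - have /andP[? ?] := x01 o1 o0; rewrite /e0.
    by case: ltP => ?; apply/andP; split; lra.
  - by rewrite xi0 add0r; case: (e1); rewrite /= ?mulr1n ?subrr lexx.
  - by have /andP[? ?] := near o1 o2 isT; apply/andP; split; lra.
  - by have /andP[? ?] := near o1 o3 isT; apply/andP; split; lra.
move: k; apply: forall_I4; last 2 first.
- by left; rewrite !inE; case: b; rewrite eqxx ?orbT.
- by left; rewrite !inE; case: b; rewrite eqxx ?orbT.
- have [->|ne_b] := eqVneq b e0.
    by right; exists P0; rewrite ?inE ?eqxx.
  by left; rewrite !inE (_ : b = ~~ e0) ?eqxx//; case: (b) (e0) ne_b => -[].
- have [->|ne_b] := eqVneq b e1.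
    by right; exists P1; rewrite ?inE ?eqxx ?orbT.
  left; rewrite !inE (_ : b = ~~ e1) ?eqxx ?orbT//.
  by case: (b) (e1) ne_b => -[].
Qed.

End FourCube.

Local Open Scope ring_scope.
Local Open Scope ereal_scope.

Theorem proposition1p2 (R : realType) : C4 R <= 96%:R%:E.
Proof.
apply: ge_ereal_sup => _ [A [x [x_cube ->]] <-].
by apply/covering_number_le; apply: coverable_familyA.
Qed.
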